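(* The identity $$x+y+xy+yx\ \approx\ x+y+xy+yx+x^{2}$$ holds in $M_2(S_7)$ and fails in $M_3(S_7)$.
   Context: $S_7=\{1,a,\infty\}$ is the additively idempotent semiring with addition $x+x=x$ and $x+y=\infty$ for $x\ne y$, and with commutative multiplication $1\cdot 1=1$, $1\cdot a=a\cdot 1=a$, $a\cdot a=\infty$, $x\cdot\infty=\infty\cdot x=\infty$ for all $x$. $M_n(S_7)$ is the semiring of all $n\times n$ matrices over $S_7$ with entrywise addition and the usual matrix multiplication $(AB)_{ij}=\sum_{k=1}^n A_{ik}B_{kj}$. *)

(* Defs.v *)
From HB Require Import structures.
From mathcomp Require Import all_boot all_order all_algebra.

Set Implicit Arguments.
Unset Strict Implicit.
Unset Printing Implicit Defensive.

Import GRing.Theory.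
Local Open Scope ring_scope.

(* MathComp's semirings have a zero, and S_7 has no additive identity (nor do
   its matrix semirings), so additively idempotent semirings are built on the
   zero-free structures: the sum is that of an addSemigroupType (commutative),
   the product [( _ * _ )%g] that of a semigroupType. *)
HB.mixin Record isAiSemiring S of GRing.AddSemigroup S & Semigroup S := {
  aiDl : @left_distributive S S *%g +%R;
  aiDr : @right_distributive S S *%g +%R;
  aixx : idempotent_op (+%R : S -> S -> S)
}.

#[short(type="aiSemiringType")]
HB.structure Definition AiSemiring :=
  {S of isAiSemiring S & GRing.AddSemigroup S & Semigroup S}.

Declare Scope ai_term_scope.
Delimit Scope ai_term_scope with ai.

Inductive ai_term : Type :=
  | Var of nat
  | Add of ai_term & ai_term
  | Mul of ai_term & ai_term.

Bind Scope ai_term_scope with ai_term.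
Notation "s + t" := (Add s t) : ai_term_scope.
Notation "s * t" := (Mul s t) : ai_term_scope.

Fixpoint ai_eval (S : aiSemiringType) (e : nat -> S) (t : ai_term) : S :=
  match t with
  | Var i => e i
  | Add s t => ai_eval e s + ai_eval e t
  | Mul s t => (ai_eval e s * ai_eval e t)%g
  end.

Definition identity_holds (S : aiSemiringType) (s t : ai_term) : Prop :=
  forall e : nat -> S, ai_eval e s = ai_eval e t.

Variant S7 : Type := S7_one | S7_a | S7_inf.

Definition S7_code (x : S7) : option bool :=
  match x with S7_one => Some true | S7_a => Some false | S7_inf => None end.
Definition S7_decode (c : option bool) : S7 :=
  match c with Some true => S7_one | Some false => S7_a | None => S7_inf end.
Lemma S7_codeK : cancel S7_code S7_decode. Proof. by case. Qed.

HB.instance Definition _ := Equality.copy S7 (can_type S7_codeK).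
HB.instance Definition _ := Choice.copy S7 (can_type S7_codeK).
HB.instance Definition _ := Countable.copy S7 (can_type S7_codeK).
HB.instance Definition _ := Finite.copy S7 (can_type S7_codeK).

Definition S7_add (x y : S7) : S7 := if x == y then x else S7_inf.

Definition S7_mul (x y : S7) : S7 :=
  match x, y with
  | S7_one, z | z, S7_one => z
  | _, _ => S7_inf
  end.

Lemma S7_addC : commutative S7_add. Proof. by case; case. Qed.
Lemma S7_addA : associative S7_add. Proof. by case; case; case. Qed.
Lemma S7_mulA : associative S7_mul. Proof. by case; case; case. Qed.
Lemma S7_mulDl : left_distributive S7_mul S7_add.
Proof. by case; case; case. Qed.
Lemma S7_mulDr : right_distributive S7_mul S7_add.
Proof. by case; case; case. Qed.
Lemma S7_addxx : idempotent_op S7_add. Proof. by case. Qed.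

HB.instance Definition _ := GRing.isAddSemigroup.Build S7 S7_addC S7_addA.
HB.instance Definition _ := isSemigroup.Build S7 S7_mulA.
HB.instance Definition _ :=
  isAiSemiring.Build S7 S7_mulDl S7_mulDr S7_addxx.

Section NonemptySum.
Variable S : aiSemiringType.

(* The sum of the nonempty family F 0, ..., F n. There is no neutral element;
   F 0 is used as the starting value of the iteration over the other terms. *)
Definition ai_sum n (F : 'I_n.+1 -> S) : S :=
  \big[+%R/F ord0]_(k < n) F (lift ord0 k).

Lemma eq_ai_sum n (F G : 'I_n.+1 -> S) : F =1 G -> ai_sum F = ai_sum G.
Proof.
by move=> FG; rewrite /ai_sum FG; apply: eq_bigr => k _; rewrite FG.
Qed.

Lemma ai_sumD n (F G : 'I_n.+1 -> S) :
  ai_sum (fun k => F k + G k) = ai_sum F + ai_sum G.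
Proof.
rewrite /ai_sum; elim/big_rec3: _ => // k x y z _ ->.
by rewrite Algebra.addrACA.
Qed.

Lemma ai_sum_mull n (F : 'I_n.+1 -> S) (c : S) :
  (ai_sum F * c)%g = ai_sum (fun k => F k * c)%g.
Proof.
exact: (big_morph (fun x => x * c)%g (fun x y => aiDl x y c) erefl).
Qed.

Lemma ai_sum_mulr n (F : 'I_n.+1 -> S) (c : S) :
  (c * ai_sum F)%g = ai_sum (fun k => c * F k)%g.
Proof. exact: (big_morph (fun x => c * x)%g (aiDr c) erefl). Qed.

Lemma ai_sum_exchange m n (F : 'I_m.+1 -> 'I_n.+1 -> S) :
  ai_sum (fun i => ai_sum (F i)) = ai_sum (fun j => ai_sum (F^~ j)).
Proof.
rewrite {1}/ai_sum.
under [RHS]eq_ai_sum do rewrite /ai_sum.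
elim: (index_enum _) => [|k s IHs].
  by rewrite big_nil; apply: eq_ai_sum => j; rewrite big_nil.
rewrite big_cons IHs -ai_sumD.
by apply: eq_ai_sum => j; rewrite big_cons.
Qed.

End NonemptySum.

(* M_n(S) for n >= 1: the dimension is written n.-1.+1 (as in {'GL_n[R]}) so
   that it is visibly positive; 'MS[S]_0 is thus the same as 'MS[S]_1. The
   alias keeps these operations apart from those of matrices over rings. *)
Definition ai_matrix (S : aiSemiringType) (n : nat) : Type :=
  'M[S]_(n.-1.+1).
Notation "''MS[' S ]_ n" := (ai_matrix S n)
  (at level 0, n at level 2, format "''MS[' S ]_ n").

Section MatrixSemiring.
Variables (S : aiSemiringType) (n : nat).
Implicit Types A B C : 'MS[S]_n.

Definition ai_addmx A B : 'MS[S]_n := \matrix_(i, j) (A i j + B i j).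

Definition ai_mulmx A B : 'MS[S]_n :=
  \matrix_(i, j) ai_sum (fun k => A i k * B k j)%g.

Lemma ai_addmxC : commutative ai_addmx.
Proof. by move=> A B; apply/matrixP => i j; rewrite !mxE Algebra.addrC. Qed.

Lemma ai_addmxA : associative ai_addmx.
Proof. by move=> A B C; apply/matrixP => i j; rewrite !mxE Algebra.addrA. Qed.

Lemma ai_addmxx : idempotent_op ai_addmx.
Proof. by move=> A; apply/matrixP => i j; rewrite !mxE aixx. Qed.

Lemma ai_mulmxA : associative ai_mulmx.
Proof.
move=> A B C; apply/matrixP => i j; rewrite !mxE.
under eq_ai_sum do rewrite mxE ai_sum_mulr.
under [RHS]eq_ai_sum do rewrite mxE ai_sum_mull.
rewrite ai_sum_exchange.
by apply: eq_ai_sum => k; apply: eq_ai_sum => l; rewrite mulgA.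
Qed.

Lemma ai_mulmxDl : left_distributive ai_mulmx ai_addmx.
Proof.
move=> A B C; apply/matrixP => i j; rewrite !mxE -ai_sumD.
by apply: eq_ai_sum => k; rewrite mxE aiDl.
Qed.

Lemma ai_mulmxDr : right_distributive ai_mulmx ai_addmx.
Proof.
move=> A B C; apply/matrixP => i j; rewrite !mxE -ai_sumD.
by apply: eq_ai_sum => k; rewrite mxE aiDr.
Qed.

HB.instance Definition _ := Choice.on 'MS[S]_n.
HB.instance Definition _ :=
  GRing.isAddSemigroup.Build 'MS[S]_n ai_addmxC ai_addmxA.
HB.instance Definition _ := isSemigroup.Build 'MS[S]_n ai_mulmxA.
HB.instance Definition _ :=
  isAiSemiring.Build 'MS[S]_n ai_mulmxDl ai_mulmxDr ai_addmxx.

End MatrixSemiring.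

(* Main.v *)
Require Import Defs.
From mathcomp Require Import all_boot all_order all_algebra.

(** Both halves rest on two facts about S7: a sum is finite (different from
    [S7_inf]) only when all its terms are equal, and [u * v = 1] only for
    [u = v = 1], while [u * v = a] only for [{u, v} = {1, a}].  Hence an entry
    [(i, j)] of the left-hand side has a finite value [c] exactly when
    [x_ij = y_ij = c] and [x_ik y_kj = y_ik x_kj = c] for every [k].  The
    identity asks for [x_ik x_kj = c], for every [k], in that situation.

    In dimension 2 there is no index besides two distinct ones.  If [i <> j],
    then [k] is one of them, and [x_ii c = x_ii y_ij = c] is already the required
    equation for [k = i], and symmetrically for [k = j].  If [i = j], then
    [k = i] gives [c * c = c], so [c = 1], and every factor occurring in the
    entry is 1.  These two cases are [offdiag_absorbs] and [diag_absorbs].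

    In dimension 3 the index [k] can differ from two distinct indices [i], [j],
    and then [c = a] can be factored crosswise: [x_ik = x_kj = 1] and
    [y_ik = y_kj = a] give [x_ik y_kj = y_ik x_kj = a], but [x_ik x_kj = 1]. *)

Set Implicit Arguments.
Unset Strict Implicit.
Unset Printing Implicit Defensive.

Import GRing.Theory.
Local Open Scope ring_scope.

(** The value of an off-diagonal entry: [u], [v] stand for [x_ij], [y_ij], and
    [p], [q] (resp. [r], [s]) for the diagonal entries of [x] (resp. [y]) in
    rows [i] and [j].  A finite value forces [p], [q], [r], [s] to be 1. *)
Lemma offdiag_absorbs (u v p q r s : S7) :
  let c := u + v + ((p * v)%g + (u * s)%g) + ((r * u)%g + (v * q)%g) in
  c = c + ((p * u)%g + (u * q)%g).
Proof. by case: u; case: v; case: p; case: q; case: r; case: s. Qed.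

(** The value of a diagonal entry: [p], [r] stand for [x_ii], [y_ii], and
    [u], [t] (resp. [v], [w]) for [x_ik], [x_ki] (resp. [y_ik], [y_ki]) with
    [k <> i].  A finite value forces all six elements to be 1. *)
Lemma diag_absorbs (p r u t v w : S7) :
  let c := p + r + ((p * r)%g + (u * w)%g) + ((r * p)%g + (v * t)%g) in
  c = c + ((p * p)%g + (u * t)%g).
Proof. by case: p; case: r; case: u; case: t; case: v; case: w. Qed.

(** In dimension 2, [rev_ord i] is the index other than [i]; putting the term
    of index [i] first treats both rows at once. *)
Lemma ai_mulmx2E (S : aiSemiringType) (A B : 'MS[S]_2) (i j : 'I_2) :
  (A * B)%g i j = (A i i * B i j)%g + (A i (rev_ord i) * B (rev_ord i) j)%g.
Proof.
rewrite mxE /ai_sum big_ord_recl big_ord0 /=.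
have -> : lift ord0 ord0 = rev_ord ord0 :> 'I_2 by apply: val_inj.
have [->|->] : i = ord0 \/ i = rev_ord ord0.
- by case: i => [[|[|//]] lti]; [left|right]; apply: val_inj.
- by rewrite Algebra.addrC.
- by rewrite rev_ordK.
Qed.

Lemma ai_addmxE (S : aiSemiringType) n (A B : 'MS[S]_n) i j :
  (A + B) i j = A i j + B i j.
Proof. exact: mxE. Qed.

Lemma M2_identity (x y : 'MS[S7]_2) :
  x + y + (x * y)%g + (y * x)%g = x + y + (x * y)%g + (y * x)%g + (x * x)%g.
Proof.
apply/matrixP => i j; rewrite !ai_addmxE !ai_mulmx2E.
have [->|->] : j = i \/ j = rev_ord i.
- by case: i j => [[|[|//]] ?] [[|[|//]] ?]; [left|right|right|left];
    apply: val_inj.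
- exact: diag_absorbs.
- exact: offdiag_absorbs.
Qed.

(** For [s = 1] and [s = a] these are the two factors of the crosswise
    factorization of [a] at the entry [(0, 2)] through [k = 1].  The diagonal is
    1 so that the terms [k = 0] and [k = 2] are [a] as well; the lower triangle
    is arbitrary, since it does not occur in this entry. *)
Definition corner_a (s : S7) : 'MS[S7]_3 :=
  \matrix_(i < 3, j < 3)
    if i == j then S7_one else if j == i.+1 :> nat then s else
    if (i < j)%N then S7_a else S7_inf.

Definition x3 : 'MS[S7]_3 := corner_a S7_one.
Definition y3 : 'MS[S7]_3 := corner_a S7_a.

(** The term of index 0 comes last because it is the starting value of the
    right fold [ai_sum]. *)
Lemma ai_mulmx3E (S : aiSemiringType) (A B : 'MS[S]_3) (i j : 'I_3) :
  (A * B)%g i j = (A i (inord 1) * B (inord 1) j)%g +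
    ((A i (inord 2) * B (inord 2) j)%g + (A i ord0 * B ord0 j)%g).
Proof.
rewrite mxE /ai_sum !big_ord_recl big_ord0 /=.
by do 2?[congr (_ + _)]; congr (A i _ * B _ j)%g; apply: val_inj;
  rewrite /= inordK.
Qed.

Lemma M3_counterexample :
  x3 + y3 + (x3 * y3)%g + (y3 * x3)%g <>
  x3 + y3 + (x3 * y3)%g + (y3 * x3)%g + (x3 * x3)%g.
Proof.
move/matrixP/(_ ord0 (inord 2)).
by rewrite !ai_addmxE !ai_mulmx3E !mxE -!val_eqE /= !inordK.
Qed.

Theorem theorem4p1 :
  let x := Var 0 in
  let y := Var 1 in
  let lhs := (x + y + x * y + y * x)%ai in
  let rhs := (x + y + x * y + y * x + x * x)%ai in
  identity_holds 'MS[S7]_2 lhs rhs /\ ~ identity_holds 'MS[S7]_3 lhs rhs.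
Proof.
split=> [e | holds3]; first exact: M2_identity.
exact: M3_counterexample (holds3 (fun i => if i is 0 then x3 else y3)).
Qed.
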